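(* Let $b>0$ be a real number. If $m=1$, $\beta=1$, $a=1$ and $c=1$, then $\mathcal{GNB\text{-}BE}(m,\beta,a,b,c)$ reduces to the Yule distribution; that is, the probability mass function of $X\sim\mathcal{GNB\text{-}BE}(1,1,1,b,1)$ is $$h_4(x)=\frac{b\,x!}{(b+1)_{(x+1)}},\qquad x=0,1,2,\dots$$
   Context: For $r,s>0$, $B(r,s)=\frac{\Gamma(r)\Gamma(s)}{\Gamma(r+s)}$. For $u>0$ and integer $s\ge 0$, $u_{(s)}=\frac{\Gamma(u+s)}{\Gamma(u)}$. For real $y$ and integer $x\ge 0$, $\binom{y}{x}=\frac{y(y-1)\cdots(y-x+1)}{x!}$. The generalized negative binomial distribution $\mathcal{GNB}(m,\beta,\theta)$ has probability mass function $\frac{m}{m+\beta x}\binom{m+\beta x}{x}(1-\theta)^{x}\theta^{m+\beta x-x}$, $x=0,1,2,\dots$. The beta exponential distribution $\mathcal{BE}(a,b,c)$, $a,b,c>0$, has density $g(\lambda;a,b,c)=\frac{c}{B(a,b)}e^{-bc\lambda}(1-e^{-c\lambda})^{a-1}$ for $\lambda>0$. The distribution $\mathcal{GNB\text{-}BE}(m,\beta,a,b,c)$ is the mixture defined by $X\mid\lambda\sim\mathcal{GNB}(m,\beta,\theta=e^{-\lambda})$, $\lambda\sim\mathcal{BE}(a,b,c)$: its mass function is $$p(x)=\int_0^\infty \frac{m}{m+\beta x}\binom{m+\beta x}{x}(1-e^{-\lambda})^{x}e^{-\lambda(m+\beta x-x)}\,g(\lambda;a,b,c)\,d\lambda,\qquad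 x=0,1,2,\dots$$ The Yule distribution is the distribution with the mass function $h_4$ displayed in the claim. *)

(* Defs.v *)
From HB Require Import structures.
From mathcomp Require Import all_boot all_order all_algebra.
From mathcomp Require Import all_classical all_reals all_analysis.

Set Implicit Arguments.
Unset Strict Implicit.
Unset Printing Implicit Defensive.

Import Order.TTheory GRing.Theory Num.Theory.
Import numFieldNormedType.Exports.

Local Open Scope classical_set_scope.
Local Open Scope ring_scope.

(* The Gamma function, as Euler's integral of the second kind; the integral
   converges for u > 0, the only arguments for which Gamma is meant. *)
Definition Gamma (R : realType) (u : R) : R :=
  \int[@lebesgue_measure R]_(t in `]0, +oo[) (t `^ (u - 1) * expR (- t)).

(* The beta function at real arguments; the library's beta_fun takes natural
   numbers only. *)
Definition Beta (R : realType) (r s : R) : R :=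
  Gamma r * Gamma s / Gamma (r + s).

(* Ascending factorial u_(s). *)
Definition ascending (R : realType) (u : R) (s : nat) : R :=
  Gamma (u + s%:R) / Gamma u.

(* Binomial coefficient with real upper argument. *)
Definition real_binomial (R : realType) (y : R) (x : nat) : R :=
  (\prod_(i < x) (y - i%:R)) / x`!%:R.

Definition gnb_pmf (R : realType) (m beta theta : R) (x : nat) : R :=
  m / (m + beta * x%:R) * real_binomial (m + beta * x%:R) x
  * (1 - theta) ^+ x * theta `^ (m + beta * x%:R - x%:R).

Definition be_pdf (R : realType) (a b c : R) : R -> R :=
  (fun lambda => c / Beta a b * expR (- (b * c * lambda))
                 * (1 - expR (- (c * lambda))) `^ (a - 1)) \_ `]0, +oo[.

(* Mass function of the mixture of GNB(m, beta, exp(-lambda)) over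
   lambda ~ BE(a, b, c). It is left extended-real valued so that an equation
   with a real number also asserts that the integral is finite. *)
Definition gnbbe_pmf (R : realType) (m beta a b c : R) (x : nat) : \bar R :=
  (\int[@lebesgue_measure R]_(lambda in `]0%R, +oo[)
     (gnb_pmf m beta (expR (- lambda)) x * be_pdf a b c lambda)%:E)%E.

Definition yule_pmf (R : realType) (b : R) (x : nat) : R :=
  b * x`!%:R / ascending (b + 1) x.+1.

(* Main.v *)
Require Import Defs.
From HB Require Import structures.
From mathcomp Require Import all_boot all_order all_algebra.
From mathcomp Require Import all_classical all_reals all_analysis.
From mathcomp Require Import measurable_realfun ring lra.

Set Implicit Arguments.
Unset Strict Implicit.
Unset Printing Implicit Defensive.

Import Order.TTheory GRing.Theory Num.Theory.
Import numFieldNormedType.Exports.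

Local Open Scope classical_set_scope.
Local Open Scope ring_scope.

(** At the parameters of the theorem the conditional mass function collapses
    to (1 - theta) ^+ x * theta, since choosing x among 1 + x objects can be
    done in 1 + x ways, which cancels the factor 1 / (1 + x) ([gnb_pmf11]).
    The mixing density becomes the exponential density with rate b, since
    Beta 1 b = 1 / b ([Beta1]). Hence the mass at x is b times the integral
    over the positive half-line of (1 - exp(- t)) ^ x * exp(- (b + 1) t).

    Write J n u for the integral of (1 - exp(- t)) ^ n * exp(- u t). Expanding
    one factor gives J n.+1 u = J n u - J n (u + 1), which together with
    J 0 u = 1 / u yields J n u = n! / (u (u + 1) ... (u + n)) by induction
    ([integral_expbeta]). For u = b + 1 and n = x the denominator is the
    ascending factorial in the Yule mass function ([ascendingE]).

    What remains are the facts on the Gamma function behind [Beta1] and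
    [ascendingE], all derived from Euler's integral: Gamma 1 = 1, the
    functional equation [GammaS] and the positivity [Gamma_gt0]. For 0 < u < 1
    the Gamma integrand is unbounded at 0, so they rest on a fundamental theorem
    of calculus on the open half-line ([ge0_improper_FTC]), and on a comparison
    of the Gamma integrand with a beta prime density, whose primitive is
    explicit ([gamma_integrand_le_betaprime]). *)

(** * Integration on the open half-line *)

Section positive_half_line.
Context {R : realType}.
Notation mu := (@lebesgue_measure R).
Notation pos := (`]0, +oo[%classic : set R).
Implicit Types (f F : R -> R) (t u : R) (k l r : R).

Lemma derive_within_continuous f (df : R -> R) :
  (forall t, 0 < t -> is_derive t 1 f (df t)) -> {within pos, continuous f}.
Proof.
move=> fdf; apply: derivable_within_continuous => t.
by rewrite in_itv/= andbT => /fdf [].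
Qed.

Lemma within_measurable f : {within pos, continuous f} -> measurable_fun pos f.
Proof. by move=> cf; apply: subspace_continuous_measurable_fun. Qed.

Lemma pos_bigcup : pos = \bigcup_n `[@harmonic R n, +oo[%classic.
Proof.
apply/seteqP; split => t /=.
  rewrite in_itv/= andbT => t0.
  have /(@cvgrPdist_lt _ _ _ _ _ _)/(_ _ t0)[n _ /(_ n (leqnn n))/=] :=
    @cvg_harmonic R.
  rewrite sub0r normrN ger0_norm ?harmonic_ge0// => hn.
  by exists n => //=; rewrite in_itv/= andbT ltW.
move=> [n _] /=; rewrite !in_itv/= !andbT; apply: lt_le_trans.
exact: harmonic_gt0.
Qed.

(** The integrand may blow up at 0: the formula holds on each half-line starting
    at 1 / (n + 1), and monotone convergence passes to the limit. *)
Lemma ge0_improper_FTC f F k l :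
  (forall t, 0 < t -> 0 <= f t) -> {within pos, continuous f} ->
  (forall t, 0 < t -> is_derive t 1 F (f t)) ->
  F t @[t --> 0^'+] --> k -> F t @[t --> +oo] --> l ->
  (\int[mu]_(t in pos) (f t)%:E = (l - k)%:E)%E.
Proof.
move=> f0 cf dF Fk Fl.
have sub n : `[@harmonic R n, +oo[%classic `<=` pos.
  by rewrite pos_bigcup => t ht; exists n.
have cF t : 0 < t -> F x @[x --> t] --> F t.
  move=> t0; have [/derivable1_diffP/differentiable_continuous] := dF _ t0.
  by [].
have intF n : (\int[mu]_(t in `[harmonic n, +oo[) (f t)%:E =
    (l - F (harmonic n))%:E)%E.
  have h0 : 0 < @harmonic R n := harmonic_gt0 n.
  rewrite (@ge0_continuous_FTC2y _ f F _ l) ?EFinB//.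
  - by move=> t ht; apply: f0; exact: lt_le_trans ht.
  - exact: continuous_subspaceW cf.
  - by move=> t ht; have [] := dF t (lt_trans h0 ht).
  - by apply: cvg_at_right_filter; exact: cF.
  - move=> t; rewrite in_itv/= andbT => ht; rewrite derive1E.
    by have [] := dF t (lt_trans h0 ht).
have c1 : (\int[mu]_(t in `[@harmonic R n, +oo[) (f t)%:E)%E @[n --> \oo] -->
    (\int[mu]_(t in pos) (f t)%:E)%E.
  rewrite pos_bigcup; apply: ge0_nondecreasing_set_cvg_integral => //=.
  - move=> m n mn; apply/subsetPset => t /=; rewrite !in_itv/= !andbT.
    apply: le_trans; rewrite /harmonic/= lef_pV2 ?posrE ?ltr0n//.
    by rewrite ler_nat ltnS.
  - move=> n; apply: (measurable_funS _ (sub n)) => //.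
    by apply/measurable_EFinP; exact: within_measurable.
  - by move=> n t /(sub n) /=; rewrite in_itv/= andbT lee_fin; exact: f0.
have c2 : (\int[mu]_(t in `[@harmonic R n, +oo[) (f t)%:E)%E @[n --> \oo] -->
    (l - k)%:E.
  under eq_fun do rewrite intF.
  apply: cvg_EFin; first by near=> n.
  apply: cvgB; first exact: cvg_cst.
  have /cvg_at_rightP/(_ (@harmonic R)) := Fk; apply; split => [n|].
    exact: harmonic_gt0.
  exact: cvg_harmonic.
exact: (cvg_unique _ c1 c2).
Unshelve. all: by end_near. Qed.

Lemma ge0_integrable_EFin f r :
  measurable_fun pos f -> (forall t, 0 < t -> 0 <= f t) ->
  (\int[mu]_(t in pos) (f t)%:E = r%:E)%E -> mu.-integrable pos (EFin \o f).
Proof.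
move=> mf f0 fr; apply/integrableP; split; first exact/measurable_EFinP.
rewrite (_ : (\int[mu]_(t in _) _)%E = r%:E) ?ltry// -fr.
apply: eq_integral => t; rewrite inE/= in_itv/= andbT => t0.
by rewrite ger0_norm// f0.
Qed.

Lemma integrableZ_EFin r f : mu.-integrable pos (EFin \o f) ->
  mu.-integrable pos (EFin \o (fun t => r * f t)).
Proof.
move=> intf; rewrite (_ : EFin \o _ = fun t => (r%:E * (f t)%:E)%E) //.
exact: integrableZl.
Qed.

Lemma integrableB_EFin f F :
  mu.-integrable pos (EFin \o f) -> mu.-integrable pos (EFin \o F) ->
  mu.-integrable pos (EFin \o (fun t => f t - F t)).
Proof.
move=> intf intF; rewrite (_ : EFin \o _ = (EFin \o f) \- (EFin \o F))%E //.
exact: integrableB.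
Qed.

(** * The functional equation of the Gamma function *)

(** Raise s / p <= exp(s / p) to the power p. *)
Lemma powR_le_expR (p : R) : 0 < p ->
  exists2 C, 0 < C & forall s, 0 < s -> s `^ p <= C * expR s.
Proof.
move=> p0; exists (p `^ p); first exact: powR_gt0.
move=> s s0.
have sp : s / p <= expR (s / p).
  by apply: le_trans (expR_ge1Dx _); rewrite lerDr.
have p0' : p != 0 by rewrite gt_eqF.
have sp0 : 0 <= s / p by rewrite divr_ge0// ltW.
rewrite -[in leLHS](@divfK _ p p0' s) powRM//; last exact: ltW.
rewrite mulrC ler_pM2l ?powR_gt0// -[in leRHS](@divfK _ p p0' s) expRM.
by apply: ge0_ler_powR; rewrite ?nnegrE ?expR_ge0// ltW.
Qed.

Definition gamma_integrand u t := t `^ (u - 1) * expR (- t).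

Lemma within_continuous_gamma_integrand u :
  {within pos, continuous (gamma_integrand u)}.
Proof.
apply: derive_within_continuous => t t0.
have h1 := is_derive1_powR (u - 1) t0.
exact: is_deriveM.
Qed.

(** The distribution function of the beta prime law with parameters u and 1;
    its density is u * betaprime_kernel u. It serves as an integrable majorant
    of the Gamma integrand with an elementary primitive: both behave like
    t `^ (u - 1) at 0. *)
Definition betaprime_cdf u t := (t / (1 + t)) `^ u.
Definition betaprime_kernel u t := (t / (1 + t)) `^ (u - 1) * (1 + t) ^- 2.

Lemma is_derive_odds t : 0 < t ->
  is_derive t 1 (fun t : R => t / (1 + t)) ((1 + t) ^- 2).
Proof.
move=> t0.
have t1 : 1 + t != 0 by rewrite gt_eqF// addr_gt0.
have dV : is_derive t 1 (fun t => (1 + t)^-1 : R) (- (1 + t) ^- 2 *: (0 + 1)).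
  exact: is_deriveV.
apply: is_derive_eq; by rewrite /GRing.scale/=; field.
Qed.

Lemma is_derive_betaprime_cdf u t : 0 < t ->
  is_derive t 1 (betaprime_cdf u) (u * betaprime_kernel u t).
Proof.
move=> t0; have t1 : 0 < t / (1 + t) by rewrite divr_gt0// addr_gt0.
have := is_derive1_comp (g := fun t : R => t / (1 + t))
  (is_derive1_powR u t1) (is_derive_odds t0).
by rewrite mulrA.
Qed.

Lemma within_continuous_betaprime_kernel u :
  {within pos, continuous (betaprime_kernel u)}.
Proof.
apply: derive_within_continuous => t t0.
have t1 : 0 < t / (1 + t) by rewrite divr_gt0// addr_gt0.
have t2 : (1 + t) ^+ 2 != 0 by rewrite gt_eqF// exprn_gt0// addr_gt0.
have h1 := is_derive1_comp (g := fun t : R => t / (1 + t))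
  (is_derive1_powR (u - 1) t1) (is_derive_odds t0).
by apply: is_deriveM; apply: is_deriveV.
Qed.

Lemma betaprime_kernelE u t : 0 < t ->
  betaprime_kernel u t = t `^ (u - 1) * (1 + t) `^ (- (u + 1)).
Proof.
move=> t0; have t1 : 0 < 1 + t by rewrite addr_gt0.
rewrite /betaprime_kernel powRM ?invr_ge0 ?(ltW t0) ?(ltW t1)// -mulrA.
congr (_ * _).
rewrite -powR_inv1 ?(ltW t1)// -powRrM -powR_invn ?(ltW t1)// -powRD; last first.
  by rewrite (gt_eqF t1) implybT.
by congr (_ `^ _); ring.
Qed.

(** The factor 1 + t makes the same constant bound both gamma_integrand u and
    gamma_integrand (u + 1), the latter being t * gamma_integrand u t. After
    cancelling t `^ (u - 1) the claim is [powR_le_expR] at 1 + t with exponent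
    u + 2. *)
Lemma gamma_integrand_le_betaprime u : 0 < u -> exists2 K, 0 < K &
  forall t, 0 < t -> (1 + t) * gamma_integrand u t <= K * betaprime_kernel u t.
Proof.
move=> u0; have p0 : 0 < u + 2 by rewrite addr_gt0.
have [C C0 hC] := powR_le_expR p0.
exists (C * expR 1); first by rewrite mulr_gt0// expR_gt0.
move=> t t0; have t1 : 0 < 1 + t by rewrite addr_gt0.
have t1' : (1 + t != 0) by rewrite gt_eqF.
have := hC _ t1; rewrite expRD mulrA betaprime_kernelE// /gamma_integrand => h.
rewrite expRN mulrCA [leRHS]mulrCA ler_pM2l ?powR_gt0//.
rewrite ler_pdivrMr ?expR_gt0// mulrAC.
rewrite powRN ler_pdivlMr ?powR_gt0//; apply: le_trans h.
rewrite -[X in X * _](@powRr1 _ (1 + t)) ?(ltW t1)// -powRD ?t1' ?implybT//.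
by rewrite (_ : 1 + (u + 1) = u + 2)//; ring.
Qed.

Lemma gamma_integrand_ge0 u t : 0 <= gamma_integrand u t.
Proof. by rewrite mulr_ge0 ?powR_ge0 ?expR_ge0. Qed.

Lemma betaprime_kernel_ge0 u t : 0 <= betaprime_kernel u t.
Proof. by rewrite mulr_ge0 ?powR_ge0// invr_ge0 sqr_ge0. Qed.

Lemma cvg_powR0 u : 0 < u -> forall f,
  (forall t, 0 < t -> 0 <= f t <= t `^ u) -> f t @[t --> 0^'+] --> (0 : R).
Proof.
move=> u0 f hf.
apply: (@squeeze_cvgr _ _ _ _ (fun=> 0) (fun t => t `^ u)).
- by near=> t; apply: hf.
- exact: cvg_cst.
- exact: powR_cvg0.
Unshelve. all: by end_near. Qed.

Lemma betaprime_cdf_cvg0 u : 0 < u ->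
  betaprime_cdf u t @[t --> 0^'+] --> (0 : R).
Proof.
move=> u0; apply: (cvg_powR0 u0) => t t0; rewrite powR_ge0/=.
have t1 : 0 < 1 + t by rewrite addr_gt0.
apply: ge0_ler_powR; rewrite ?nnegrE ?divr_ge0 ?(ltW t0) ?(ltW t1) ?(ltW u0)//.
by rewrite ler_pdivrMr// ler_peMr ?(ltW t0)// lerDl ltW.
Qed.

Lemma cvg_invr_shift (a : R) : (a + t)^-1 @[t --> +oo] --> (0 : R).
Proof.
apply/gtr0_cvgV0; last exact: cvg_addrl.
near=> t; rewrite -ltrBlDl sub0r; near: t; apply: nbhs_pinfty_gt.
exact: num_real.
Unshelve. all: by end_near. Qed.

Lemma betaprime_cdf_cvgy u : betaprime_cdf u t @[t --> +oo] --> (1 : R).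
Proof.
have c1 : t / (1 + t) @[t --> +oo] --> (1 : R).
  have : 1 - (1 + t)^-1 @[t --> +oo] --> (1 - 0 : R).
    by apply: cvgB; [exact: cvg_cst|exact: cvg_invr_shift].
  rewrite subr0; apply: cvg_trans; apply: near_eq_cvg; near=> t.
  have t0 : 0 < t by near: t; exact: nbhs_pinfty_gt.
  by field; rewrite gt_eqF// addr_gt0.
have [/derivable1_diffP/differentiable_continuous c _] :=
  is_derive1_powR u (@ltr01 R).
have {c} : s `^ u @[s --> (1 : R)] --> (1 : R) `^ u := c.
rewrite powR1; exact: cvg_comp c1.
Unshelve. all: by end_near. Qed.

Lemma gamma_boundary_cvg0 u : 0 < u ->
  t `^ u * expR (- t) @[t --> 0^'+] --> (0 : R).
Proof.
move=> u0; apply: (cvg_powR0 u0) => t t0.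
rewrite mulr_ge0 ?powR_ge0 ?expR_ge0//= ler_piMr ?powR_ge0//.
by rewrite -expR0 ler_expR oppr_le0 ltW.
Qed.

Lemma gamma_boundary_cvgy u : 0 < u ->
  t `^ u * expR (- t) @[t --> +oo] --> (0 : R).
Proof.
move=> u0; have p0 : 0 < u + 1 by rewrite addr_gt0.
have [C C0 hC] := powR_le_expR p0.
apply: (@squeeze_cvgr _ _ _ _ (fun=> 0) (fun t => C * (0 + t)^-1)).
- near=> t; have t0 : 0 < t by near: t; exact: nbhs_pinfty_gt.
  rewrite mulr_ge0 ?powR_ge0 ?expR_ge0//= add0r ler_pdivlMr//.
  rewrite expRN mulrAC ler_pdivrMr ?expR_gt0//; apply: le_trans (hC _ t0).
  by rewrite powRD ?powRr1 ?(ltW t0)// gt_eqF ?implybT.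
- exact: cvg_cst.
- rewrite -[X in _ --> X](mulr0 C).
  by apply: cvgM; [exact: cvg_cst|exact: cvg_invr_shift].
Unshelve. all: by end_near. Qed.

Lemma measurable_gamma_integrand u : measurable_fun pos (gamma_integrand u).
Proof. apply: within_measurable; exact: within_continuous_gamma_integrand. Qed.

Lemma integral_betaprime_kernel u : 0 < u ->
  (\int[mu]_(t in pos) (u * betaprime_kernel u t)%:E = 1%:E)%E.
Proof.
move=> u0; have -> : 1%:E = (1 - 0)%:E :> \bar R by rewrite subr0.
apply: (ge0_improper_FTC (F := betaprime_cdf u)).
- by move=> t t0; rewrite mulr_ge0 ?betaprime_kernel_ge0// ltW.
- move=> t; apply: cvgM; first exact: cvg_cst.
  exact: within_continuous_betaprime_kernel.
- exact: is_derive_betaprime_cdf.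
- exact: betaprime_cdf_cvg0.
- exact: betaprime_cdf_cvgy.
Qed.

Lemma integrable_betaprime_kernel u : 0 < u ->
  mu.-integrable pos (EFin \o (fun t => u * betaprime_kernel u t)).
Proof.
move=> u0; apply: (ge0_integrable_EFin _ _ (integral_betaprime_kernel u0)).
  apply: measurable_funM => //.
  apply: within_measurable; exact: within_continuous_betaprime_kernel.
by move=> t t0; rewrite mulr_ge0 ?betaprime_kernel_ge0// ltW.
Qed.

Lemma integrable_gamma_integrand u : 0 < u ->
  mu.-integrable pos (EFin \o gamma_integrand u).
Proof.
move=> u0; have [K K0 hK] := gamma_integrand_le_betaprime u0.
apply: (@le_integrable _ _ _ mu pos _ _
  (EFin \o (fun t => K / u * (u * betaprime_kernel u t)))) => //.
- by apply/measurable_EFinP; exact: measurable_gamma_integrand.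
- move=> t /=; rewrite in_itv/= andbT => t0.
  have Kd : 0 <= K * betaprime_kernel u t.
    by rewrite mulr_ge0 ?betaprime_kernel_ge0 ?(ltW K0).
  rewrite mulrA divfK ?gt_eqF// lee_fin !ger0_norm ?gamma_integrand_ge0//.
  apply: le_trans (hK _ t0).
  by rewrite ler_peMl ?gamma_integrand_ge0// lerDl ltW.
- by apply: integrableZ_EFin; exact: integrable_betaprime_kernel.
Qed.

(** Integration by parts would integrate u * g u - g (u + 1), the derivative of
    t `^ u * exp(- t), which changes sign. Adding a large multiple of the beta
    prime density makes it nonnegative, so that [ge0_improper_FTC] applies;
    the boundary terms of t `^ u * exp(- t) vanish and the added part
    contributes the same amount to both sides. *)
Lemma GammaS u : 0 < u -> Gamma (u + 1) = u * Gamma u.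
Proof.
move=> u0; have [K K0 hK] := gamma_integrand_le_betaprime u0.
have u1 : 0 < u + 1 by rewrite addr_gt0.
have gS t : gamma_integrand (u + 1) t = t `^ u * expR (- t).
  by rewrite /gamma_integrand addrK.
pose f t := u * gamma_integrand u t - gamma_integrand (u + 1) t
            + K / u * (u * betaprime_kernel u t).
have intf : (\int[mu]_(t in pos) (f t)%:E = (K / u)%:E)%E.
  rewrite -[in RHS](subr0 (K / u)).
  apply: (ge0_improper_FTC
    (F := fun t => t `^ u * expR (- t) + K / u * betaprime_cdf u t)).
  - move=> t t0; rewrite /f (mulrA (K / u)) divfK ?gt_eqF// -addrA addr_ge0//.
      by rewrite mulr_ge0 ?gamma_integrand_ge0// ltW.
    rewrite addrC subr_ge0; apply: le_trans (hK _ t0).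
    rewrite gS -(mulr_powRB1 (ltW t0) u0) -mulrA.
    by rewrite ler_wpM2r ?gamma_integrand_ge0// lerDr.
  - move=> t; apply: cvgD; first apply: cvgB.
    + by apply: cvgM; [exact: cvg_cst|exact: within_continuous_gamma_integrand].
    + exact: within_continuous_gamma_integrand.
    + do 2 (apply: cvgM; first exact: cvg_cst).
      exact: within_continuous_betaprime_kernel.
  - move=> t t0.
    have h1 := is_derive1_powR u t0.
    have h2 := is_derive_betaprime_cdf u t0.
    apply: is_derive_eq; rewrite /f gS /gamma_integrand /GRing.scale/=.
    ring.
  - have := cvgD (gamma_boundary_cvg0 u0)
      (cvgM (cvg_cst (K / u)) (betaprime_cdf_cvg0 u0)).
    by rewrite mulr0 addr0; apply.
  - have := cvgD (gamma_boundary_cvgy u0)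
      (cvgM (cvg_cst (K / u)) (betaprime_cdf_cvgy u)).
    by rewrite mulr1 add0r; apply.
have i1 := integrable_gamma_integrand u0.
have i2 := integrable_gamma_integrand u1.
have i3 := integrable_betaprime_kernel u0.
have : \int[mu]_(t in pos) f t = K / u by rewrite /Rintegral intf.
have iB : mu.-integrable pos
    (EFin \o (fun t => u * gamma_integrand u t - gamma_integrand (u + 1) t)).
  by apply: integrableB_EFin => //; exact: integrableZ_EFin.
rewrite RintegralD//; last exact: integrableZ_EFin.
rewrite RintegralB//; last exact: integrableZ_EFin.
rewrite [X in _ + X = _]RintegralZl// [X in _ + _ * X = _]/Rintegral.
rewrite integral_betaprime_kernel//= RintegralZl// -/(Gamma _) -/(Gamma _); lra.
Qed.

(** * Normalization, positivity and ascending factorials *)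

Lemma is_derive_expRN u t :
  is_derive t 1 (fun t : R => expR (- (u * t))) (- u * expR (- (u * t))).
Proof. by apply: is_derive_eq; rewrite /GRing.scale/=; ring. Qed.

Lemma continuous_expRN u : continuous (fun t : R => expR (- (u * t))).
Proof.
move=> t; have [/derivable1_diffP/differentiable_continuous c _] :=
  is_derive_expRN u t.
exact: c.
Qed.

Lemma integral_expRN u : 0 < u ->
  (\int[mu]_(t in pos) (expR (- (u * t)))%:E = (u^-1)%:E)%E.
Proof.
move=> u0; have -> : u^-1 = - u^-1 * 0 - (- u^-1 * 1) by ring.
have u0' : u != 0 by rewrite gt_eqF.
apply: (ge0_improper_FTC (F := fun t => - u^-1 * expR (- (u * t)))) => //.
- by apply: derive_within_continuous => t _; exact: is_derive_expRN.
- move=> t _; have dt := is_derive_expRN u t.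
  by apply: is_derive_eq; rewrite /GRing.scale/=; field.
- apply: cvgM; first exact: cvg_cst.
  apply: cvg_at_right_filter.
  have -> : 1 = expR (- (u * 0)) by rewrite mulr0 oppr0 expR0.
  exact: continuous_expRN.
- apply: cvgM; first exact: cvg_cst.
  apply: (@cvg_comp _ _ _ (fun t => u * t) (fun s => expR (- s))
    _ (pinfty_nbhs R)); last exact: cvgr_expR.
  exact: gt0_cvgMry.
Qed.

Lemma Gamma1 : Gamma 1 = 1 :> R.
Proof.
rewrite /Gamma /Rintegral; under eq_integral do
  rewrite subrr powRr0 mul1r -[t in - t]mul1r.
by rewrite integral_expRN// invr1.
Qed.

(** A vanishing integral would force the positive integrand to vanish almost
    everywhere on a set of infinite measure. *)
Lemma Gamma_gt0 u : 0 < u -> 0 < Gamma u.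
Proof.
move=> u0; rewrite lt_neqAle Rintegral_ge0 ?andbT; last first.
  by move=> t _; exact: gamma_integrand_ge0.
rewrite eq_sym; apply/eqP.
have iu := integrable_gamma_integrand u0.
rewrite /Gamma -/(gamma_integrand u) => I0.
have : (\int[mu]_(t in pos) `|(gamma_integrand u t)%:E| = 0)%E.
  under eq_integral do rewrite /= ger0_norm ?gamma_integrand_ge0//.
  rewrite -[LHS]fineK; last exact: integrable_fin_num iu.
  by rewrite -[fine _]/(Rintegral _ _ _) I0.
have mg : measurable_fun pos (EFin \o gamma_integrand u).
  by apply/measurable_EFinP; exact: measurable_gamma_integrand.
move=> /(ae_eq_integral_abs mu (measurable_itv _) mg)[N [mN N0 hN]].
have posN : pos `<=` N.
  move=> t tpos; apply: hN => /= /(_ tpos)[] /eqP; apply/negP.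
  move: tpos; rewrite /= in_itv/= andbT => t0.
  by rewrite gt_eqF// mulr_gt0 ?powR_gt0 ?expR_gt0.
have : (mu pos <= mu N)%E by apply: le_measure; rewrite ?inE.
by rewrite N0 lebesgue_measure_itv/= ltry addye.
Qed.

Lemma ascendingE u n : 0 < u -> ascending u n = \prod_(i < n) (u + i%:R).
Proof.
move=> u0; rewrite /ascending; elim: n => [|n IH].
  by rewrite addr0 big_ord0 divff// gt_eqF// Gamma_gt0.
have un : 0 < u + n%:R by rewrite ltr_wpDr.
by rewrite big_ord_recr/= -IH -natr1 addrA GammaS//; ring.
Qed.

Lemma Beta1 u : 0 < u -> Beta 1 u = u^-1.
Proof.
move=> u0; rewrite /Beta addrC GammaS// Gamma1 mul1r invfM mulrCA divff ?mulr1//.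
by rewrite gt_eqF// Gamma_gt0.
Qed.

(** * The mixture integral *)

(** The integrand of Euler's beta integral with parameters u and n + 1 after
    the substitution s = exp(- t). *)
Definition expbeta_integrand n u t := (1 - expR (- t)) ^+ n * expR (- (u * t)).

Lemma within_continuous_expbeta_integrand n u :
  {within pos, continuous (expbeta_integrand n u)}.
Proof.
apply: continuous_subspaceT => t; apply: cvgM; last exact: continuous_expRN.
apply: (@continuous_comp _ _ _ (fun t => 1 - expR (- t)) (fun s => s ^+ n)).
  apply: cvgB; first exact: cvg_cst.
  by have := @continuous_expRN 1 t; under eq_fun do rewrite mul1r.
exact: exprn_continuous.
Qed.

(** Multiplying out one factor 1 - exp(- t) reduces the exponent n + 1 at u to the
    exponent n at u and at u + 1. *)
Lemma integral_expbeta n u : 0 < u ->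
  mu.-integrable pos (EFin \o expbeta_integrand n u) /\
  \int[mu]_(t in pos) expbeta_integrand n u t =
    n`!%:R / \prod_(i < n.+1) (u + i%:R).
Proof.
elim: n u => [|n IH] u u0.
  have E : expbeta_integrand 0 u = fun t => expR (- (u * t)).
    by apply/funext => t; rewrite /expbeta_integrand expr0 mul1r.
  have I := integral_expRN u0.
  split.
    rewrite E; apply: (ge0_integrable_EFin _ _ I) => //; rewrite -E.
    by apply: within_measurable; exact: within_continuous_expbeta_integrand.
  by rewrite E /Rintegral I/= big_ord1 addr0 mul1r.
have u1 : 0 < u + 1 by rewrite addr_gt0.
have [i1 v1] := IH _ u0; have [i2 v2] := IH _ u1.
have E : expbeta_integrand n.+1 u =
    fun t => expbeta_integrand n u t - expbeta_integrand n (u + 1) t.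
  apply/funext => t; rewrite /expbeta_integrand exprSr mulrDl mul1r opprD expRD.
  ring.
rewrite E RintegralB// v1 v2; split; first exact: integrableB_EFin.
(* P collects the factors shared by the two denominators, which extend it by u
   on the one hand and by u + n + 1 on the other. *)
pose P := \prod_(i < n) (u + i.+1%:R).
have P0 : P != 0 by apply/prodf_neq0 => i _; rewrite gt_eqF// ltr_wpDr.
have eP : \prod_(i < n) (u + 1 + i%:R) = P.
  by apply: eq_bigr => i _; rewrite -addrA nat1r.
rewrite [in LHS]big_ord_recl [in X in _ - X]big_ord_recr/= eP.
rewrite [in RHS]big_ord_recl [in RHS]big_ord_recr/=.
under eq_bigr do rewrite /bump/= add1n.
rewrite -/P addr0 factS natrM.
have un : u + n.+1%:R != 0 by rewrite gt_eqF// ltr_wpDr.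
rewrite /bump/= add1n -!natr1 in un *.
by field; rewrite un P0 gt_eqF.
Qed.

Lemma real_binomial_pred n : real_binomial (n.+1%:R : R) n = n.+1%:R.
Proof.
rewrite /real_binomial.
have -> : \prod_(i < n) (n.+1%:R - i%:R : R) = (n.+1 ^_ n)%:R.
  rewrite ffact_prod natr_prod; apply: eq_bigr => i _.
  by rewrite natrB// ltnW// ltnS ltnW.
have := ffact_fact (leqnSn n); rewrite subSnn muln1 => ->.
by rewrite factS natrM mulfK// pnatr_eq0 -lt0n fact_gt0.
Qed.

Lemma gnb_pmf11 (theta : R) n : 0 <= theta ->
  gnb_pmf 1 1 theta n = (1 - theta) ^+ n * theta.
Proof.
move=> theta0; rewrite /gnb_pmf !mul1r nat1r real_binomial_pred.
by rewrite mulVf ?pnatr_eq0// mul1r -nat1r addrK powRr1.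
Qed.

End positive_half_line.

Theorem mainTheorem4 (R : realType) (b : R) (hb : 0 < b) (x : nat) :
  gnbbe_pmf 1 1 1 b 1 x = (yule_pmf b x)%:E.
Proof.
have b1 : 0 < b + 1 by rewrite addr_gt0.
have [intL valL] := integral_expbeta x b1.
have -> : gnbbe_pmf 1 1 1 b 1 x =
    (\int[@lebesgue_measure R]_(t in `]0%R, +oo[)
       (b%:E * (expbeta_integrand x (b + 1) t)%:E))%E.
  apply: eq_integral => t tpos; rewrite /be_pdf patchE tpos.
  rewrite gnb_pmf11 ?expR_ge0//.
  rewrite subrr powRr0 Beta1// invrK mul1r mulr1 mulr1 -EFinM; congr EFin.
  by rewrite /expbeta_integrand mulrDl mul1r opprD expRD; ring.
rewrite integralZl// -[X in (_ * X)%E]fineK ?integrable_fin_num//.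
rewrite -[fine _]/(Rintegral _ _ _) valL -EFinM /yule_pmf ascendingE//.
by rewrite mulrA.
Qed.
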